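(* Let $C=C_0(d)$ for some fixed integer $d\ge1$, and fix any constant $\epsilon>0$. For $\vec{\bm x}$ drawn uniformly from $[0:M-1]^n$ and any integer $\tau$ satisfying $|\tau|=o(Mn)$, we have \[ \Pr_{\vec{\bm x}}\big[\exists\,\vec c\in C^n\setminus\{\vec 0\}:\ \vec{\bm x}\cdot\vec c=\tau\big]\;\; \begin{cases}\ge 1-e^{-\Omega(n)} & \text{if } M\le |C|^{(1-\epsilon)n},\\[0.3ex] \le |C|^n/M & \text{if } M\ge |C|^n.\end{cases} \]
   Context: $[a:b]=\{a,a+1,\dots,b\}$ and $C_0(d)=\{0,\pm1,\dots,\pm d\}$. Asymptotics are as $n\to\infty$ with $d,\epsilon$ fixed; $M$ and $\tau$ may depend on $n$. Standing assumption: $M=|C|^{\Omega(n)}$. *)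

(* Defs.v *)
From HB Require Import structures.
From mathcomp Require Import all_boot all_order all_algebra finmap.
From mathcomp Require Import all_classical all_reals all_analysis.
From mathcomp Require Import zify.

Set Implicit Arguments.
Unset Strict Implicit.
Unset Printing Implicit Defensive.

Import Order.TTheory GRing.Theory Num.Theory.
Import numFieldNormedType.Exports.

Local Open Scope fset_scope.
Local Open Scope ring_scope.

(* The integers of absolute value at most d ([in_C0]). *)
Definition C0 (d : nat) : {fset int} :=
  [fset x in [seq k%:Z - d%:Z | k <- iota 0 (2 * d).+1]].

Lemma in_C0 (d : nat) (z : int) : (z \in C0 d) = (`|z| <= d%:Z).
Proof.
rewrite /C0 in_fset; apply/idP/idP => [/mapP[k]|].
  by rewrite mem_iota => /andP[_ kd] ->; rewrite ler_norml; lia.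
rewrite ler_norml => /andP[zl zr]; apply/mapP; exists (absz (z + d%:Z)); last lia.
by rewrite mem_iota; lia.
Qed.

Lemma card_C0 (d : nat) : #|` C0 d| = (2 * d).+1.
Proof.
rewrite card_fseq undup_id ?size_map ?size_iota //.
by rewrite map_inj_uniq ?iota_uniq // => i j /addIr [].
Qed.

(* Probability of the event A under the uniform distribution on T. *)
Definition unif_prob (R : realType) (T : finType) (A : {set T}) : R :=
  #|A|%:R / #|T|%:R.

(* [0 : M-1]^n is the type {ffun 'I_n -> 'I_M}, and C^n is {ffun 'I_n -> C}
   with C coerced to the finite type of its elements. *)
Definition solvable_instances (C : {fset int}) (n M : nat) (tau : int) :
    {set {ffun 'I_n -> 'I_M}} :=
  [set x : {ffun 'I_n -> 'I_M} |
    [exists c : {ffun 'I_n -> C},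
      [exists i, val (c i) != 0] &&
      (\sum_(i < n) (x i : nat)%:Z * val (c i) == tau)]].

(* Main.v *)
Require Import Defs.
From HB Require Import structures.
From mathcomp Require Import all_boot all_order all_algebra finmap.
From mathcomp Require Import all_classical all_reals all_analysis.
From mathcomp Require Import zify ring lra.
(* all_classical shadows the finset names [setP], [subsetP], [setX], ... *)
From mathcomp Require Import fintype finset.

(* The upper bound is a union bound. For the lower bound, split the n
   coordinates as 1 + n1 + n2, where n2 is about (eps / 2) n and
   M <= |C|^n1. The first coordinate gets coefficient 1, so the solution is
   nonzero. For the vector x of the n1 middle coordinates, a second moment
   bound shows that at least half of all c satisfy |x.c| < w M with w a
   small multiple of n; by Cauchy-Schwarz and pigeonhole the values x.c
   have density at least |C|^(2 n1) / (16 w^2 M coll(x)) in some window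
   [a, a + M), where coll(x) counts the pairs with x.c = x.c', and E coll(x) is
   at most 2 |C|^(2 n1) / M. The last n2 coordinates, used with coefficients in
   {-1, 0, 1}, first bring the target into the window and then enlarge the set
   S of reachable points of the window: a new coordinate multiplies the
   expectation of 1 / |S| by at most 11 / 12 while |S| <= M / 2, and afterwards
   hits the target with probability at least 1 / 4. The resulting failure
   probability is linear in coll(x), so only its expectation is needed, and no
   concentration. *)

Set Implicit Arguments.
Unset Strict Implicit.
Unset Printing Implicit Defensive.

Import Order.TTheory GRing.Theory Num.Theory.
Import numFieldNormedType.Exports.

Local Open Scope ring_scope.

(** * Counting the solutions of one linear equation *)

Definition dotp n M (x : {ffun 'I_n -> 'I_M}) (c : 'I_n -> int) : int :=
  \sum_(i < n) (x i : nat)%:Z * c i.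

(** Since [c i] is nonzero, the other coordinates of a solution determine its coordinate [i]; hence
    overwriting that coordinate with an arbitrary value is injective on pairs of a solution and a
    value. The coefficients are arbitrary integers because differences of two vectors over [C] occur
    as well. *)
Lemma card_dotp_eq n M (c : 'I_n -> int) i t : c i != 0 ->
  (#|[set x : {ffun 'I_n -> 'I_M} | dotp x c == t]| * M <= M ^ n)%N.
Proof.
move=> ci0; set A := [set x | _].
pose f (p : {ffun 'I_n -> 'I_M} * 'I_M) : {ffun 'I_n -> 'I_M} :=
  [ffun j => if j == i then p.2 else p.1 j].
have finj : {in setX A [set: 'I_M] &, injective f}.
  move=> [x y] [x' y'] /setXP[]; rewrite inE => /eqP hx _ /setXP[].
  rewrite inE => /eqP hx' _ /ffunP e.
  have xx' j : j != i -> x j = x' j.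
    by move=> ji; move: (e j); rewrite !ffunE (negPf ji).
  have yy' : y = y' by move: (e i); rewrite !ffunE eqxx.
  rewrite yy'; congr (_, _); apply/ffunP => j.
  have [->|/xx' //] := eqVneq j i.
  move: hx; rewrite -hx' /dotp (bigD1 i) //= [RHS](bigD1 i) //=.
  rewrite (eq_bigr (fun j => (x' j : nat)%:Z * c j)); last by move=> k /xx' ->.
  by move=> /addIr /(mulIf ci0) [] /val_inj.
have := max_card (f @: setX A [set: 'I_M]).
by rewrite card_in_imset // cardsX cardsT card_ffun !card_ord.
Qed.

(** * All coefficient vectors over [C]: union bound, collisions, second moment *)

Section Coefficients.
Variable d : nat.

Let C := C0 d : finType.

Lemma card_coefs n : #|{: {ffun 'I_n -> C}}| = ((2 * d).+1 ^ n)%N.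
Proof. by rewrite card_ffun card_ord -cardfE card_C0. Qed.

Lemma coef_le (a : C) : `|val a| <= d%:Z.
Proof. by rewrite -in_C0; exact: valP. Qed.

Lemma solvable_union_bound n M tau :
  (#|solvable_instances (C0 d) n M tau| * M <= (2 * d).+1 ^ n * M ^ n)%N.
Proof.
pose B (c : {ffun 'I_n -> C}) :=
  [set x : {ffun 'I_n -> 'I_M} | dotp x (fun i => val (c i)) == tau].
pose nz (c : {ffun 'I_n -> C}) := [exists i, val (c i) != 0].
have sub : solvable_instances (C0 d) n M tau \subset \bigcup_(c | nz c) B c.
  apply/subsetP => x; rewrite inE => /existsP[c /andP[c0 h]].
  by apply/bigcupP; exists c => //; rewrite inE.
have le1 : (#|solvable_instances (C0 d) n M tau| <= \sum_(c | nz c) #|B c|)%N.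
  apply: leq_trans (subset_leq_card sub) _.
  apply: (big_ind2 (fun (X : {set _}) k => #|X| <= k)%N) => //.
    by rewrite cards0.
  move=> X1 k1 X2 k2 h1 h2.
  by rewrite (leq_trans (leq_card_setU _ _)) // leq_add.
apply: leq_trans (leq_mul le1 (leqnn M)) _.
rewrite big_distrl /=.
apply: leq_trans (_ : \sum_(c | nz c) M ^ n <= _)%N.
  by apply: leq_sum => c /existsP[i ci]; exact: card_dotp_eq ci.
by rewrite sum_nat_const leq_mul2r -card_coefs max_card orbT.
Qed.

Definition collisions n M (x : {ffun 'I_n -> 'I_M}) :
    {set {ffun 'I_n -> C} * {ffun 'I_n -> C}} :=
  [set p : {ffun 'I_n -> C} * {ffun 'I_n -> C} |
    dotp x (fun i => val (p.1 i)) == dotp x (fun i => val (p.2 i))].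

(** Two distinct vectors collide for at most a fraction [1 / M] of the [x], and equal ones for every
    [x]. The hypothesis on [M] keeps the diagonal contribution no larger than the bound for the
    other pairs, whence the factor 2. *)
Lemma sum_collisions n M : (M <= (2 * d).+1 ^ n)%N ->
  (\sum_(x : {ffun 'I_n -> 'I_M}) #|collisions x| * M
     <= 2 * (2 * d).+1 ^ (2 * n) * M ^ n)%N.
Proof.
move=> hM.
pose D (p : {ffun 'I_n -> C} * {ffun 'I_n -> C}) :=
  [set x : {ffun 'I_n -> 'I_M} |
    dotp x (fun i => val (p.1 i)) == dotp x (fun i => val (p.2 i))].
have -> : (\sum_(x : {ffun 'I_n -> 'I_M}) #|collisions x| * M
   = \sum_p #|D p| * M)%N.
  rewrite -!big_distrl /=; congr (_ * _)%N.
  under eq_bigr do rewrite -sum1_card.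
  under [RHS]eq_bigr do rewrite -sum1_card.
  rewrite (exchange_big_dep predT) //=; apply: eq_bigr => p _.
  by apply: eq_bigl => x; rewrite !inE.
have cD p : p.1 != p.2 -> (#|D p| * M <= M ^ n)%N.
  move=> /eqP p12.
  have [i pi] : exists i, val (p.1 i) - val (p.2 i) != 0.
    apply/not_existsP => h; apply: p12; apply/ffunP => i; apply: val_inj.
    by apply/eqP; rewrite -subr_eq0; apply/negPn/negP/h.
  have := @card_dotp_eq n M (fun i => val (p.1 i) - val (p.2 i)) i 0 pi.
  apply: leq_trans; rewrite leq_mul2r; apply/orP; right.
  apply: subset_leq_card; apply/subsetP => x; rewrite !inE -subr_eq0.
  by rewrite /dotp -sumrB => /eqP h; rewrite -[X in _ == X]h;
     apply/eqP/eq_bigr => j _; rewrite mulrBr.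
rewrite (bigID (fun p => p.1 == p.2)) /=.
apply: leq_trans (_ : (2 * d).+1 ^ n * (M ^ n * M) +
  (2 * d).+1 ^ (2 * n) * M ^ n <= _)%N; last first.
  rewrite (mulnC 2 n) expnM; move: hM; set e := (_ ^ n)%N; set b := (M ^ n)%N.
  by move=> /(leq_mul (leqnn (e * b))); lia.
apply: leq_add.
  apply: leq_trans (_ : \sum_(p : {ffun 'I_n -> C} * {ffun 'I_n -> C}
    | p.1 == p.2) M ^ n * M <= _)%N.
    apply: leq_sum => p _; rewrite leq_mul2r; apply/orP; right.
    by rewrite (leq_trans (max_card _)) // card_ffun !card_ord.
  rewrite sum_nat_const leq_mul2r; apply/orP; right.
  rewrite -card_coefs -(card_imset _ (f := fun c : {ffun 'I_n -> C} => (c, c))).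
    apply: subset_leq_card; apply/subsetP => -[c c'].
    move=> h; have /eqP-> : c == c' := h; exact: imset_f.
  by move=> c c' [].
apply: leq_trans (_ : \sum_(p : {ffun 'I_n -> C} * {ffun 'I_n -> C}
    | p.1 != p.2) M ^ n <= _)%N.
  by apply: leq_sum => p /cD.
rewrite sum_nat_const leq_mul2r; apply/orP; right.
rewrite (leq_trans (max_card _)) // card_prod !card_coefs.
by rewrite -expnD (mul2n n) addnn.
Qed.

Lemma opp_coef_subproof (a : C) : - val a \in C0 d.
Proof. by rewrite in_C0 normrN coef_le. Qed.

Definition opp_coef (a : C) : C := FSetSub (opp_coef_subproof a).

Lemma val_opp_coef a : val (opp_coef a) = - val a. Proof. by []. Qed.

(** Flipping the sign of [c i] is an involution that negates each summand, so the sum equals its own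
    negative. *)
Lemma sum_coef_cross n (i j : 'I_n) : i != j ->
  \sum_(c : {ffun 'I_n -> C}) val (c i) * val (c j) = 0.
Proof.
move=> ij.
pose h (c : {ffun 'I_n -> C}) : {ffun 'I_n -> C} :=
  [ffun k => if k == i then opp_coef (c k) else c k].
have hK : involutive h.
  move=> c; apply/ffunP => k; rewrite !ffunE; case: (k == i) => //.
  by apply: val_inj; rewrite !val_opp_coef opprK.
set s := \sum_c _.
have : s = - s.
  rewrite {1}/s (reindex_inj (inv_inj hK)) -sumrN; apply: eq_bigr => c _.
  by rewrite !ffunE eqxx (negPf (_ : j != i)) 1?eq_sym // val_opp_coef mulNr.
lia.
Qed.

(** Expanding the square, the cross terms cancel and each of the [n] diagonal terms contributes at
    most [(M * d) ^ 2] per vector. *)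
Lemma dotp_second_moment n M (x : {ffun 'I_n -> 'I_M}) :
  \sum_(c : {ffun 'I_n -> C}) dotp x (fun i => val (c i)) ^+ 2
    <= ((2 * d).+1 ^ n * (n * (M * d) ^ 2))%N%:Z.
Proof.
have -> : \sum_(c : {ffun 'I_n -> C}) dotp x (fun i => val (c i)) ^+ 2 =
  \sum_(i < n) \sum_(j < n) (x i : nat)%:Z * (x j : nat)%:Z *
    \sum_(c : {ffun 'I_n -> C}) val (c i) * val (c j).
  under eq_bigr do rewrite expr2 /dotp big_distrlr /=.
  rewrite exchange_big; apply: eq_bigr => i _.
  rewrite exchange_big; apply: eq_bigr => j _.
  by rewrite big_distrr; apply: eq_bigr => c _; rewrite /=; ring.
have -> : ((2 * d).+1 ^ n * (n * (M * d) ^ 2))%N%:Z =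
   \sum_(i < n) ((2 * d).+1 ^ n * (M * d) ^ 2)%N%:Z.
  by rewrite sumr_const card_ord -mulr_natl; lia.
apply: ler_sum => i _; rewrite (bigD1 i) //=.
rewrite [X in _ + X]big1 ?addr0; last first.
  by move=> j ji; rewrite (sum_coef_cross (_ : i != j)) 1?eq_sym // mulr0.
have : \sum_(c : {ffun 'I_n -> C}) val (c i) * val (c i)
   <= ((2 * d).+1 ^ n * d ^ 2)%N%:Z.
  rewrite PoszM -card_coefs -[Posz #|_|]natz mulr_natl -sumr_const.
  apply: ler_sum => c _; have := coef_le (c i); set v := val (c i).
  by rewrite ler_norml -mulnn => /andP[]; nia.
have : 0 <= \sum_(c : {ffun 'I_n -> C}) val (c i) * val (c i).
  by apply: sumr_ge0 => c _; rewrite -expr2 sqr_ge0.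
have := ltn_ord (x i); set s := \sum_c _; set e := (_ ^ n)%N.
move=> xM s0 se.
have : ((x i * x i)%N%:Z <= (M * M)%N%:Z) by rewrite lez_nat; nia.
rewrite PoszM => hx.
have -> : (e * (M * d) ^ 2)%N%:Z = (M * M)%N%:Z * (e * d ^ 2)%N%:Z by lia.
by apply: ler_pM => //; lia.
Qed.

Definition small_coefs n M (x : {ffun 'I_n -> 'I_M}) (w : nat) :
    {set {ffun 'I_n -> C}} :=
  [set c : {ffun 'I_n -> C} | `|dotp x (fun i => val (c i))| < (w * M)%N%:Z].

(** Chebyshev: the vectors outside make up a fraction at most [n * d ^ 2 / w ^ 2], which the
    condition on [w] puts below one half. *)
Lemma card_small_coefs n M (x : {ffun 'I_n -> 'I_M}) w : (0 < M)%N ->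
  (2 * d ^ 2 * n < w ^ 2)%N ->
  ((2 * d).+1 ^ n <= 2 * #|small_coefs x w|)%N.
Proof.
move=> M0 hw.
have := dotp_second_moment x.
rewrite (bigID (mem (small_coefs x w))) /=.
set s1 := (X in X + _); set s2 := (X in _ + X).
have s10 : 0 <= s1 by apply: sumr_ge0 => c _; exact: sqr_ge0.
have hs2 : (#|~: small_coefs x w| * (w * M) ^ 2)%N%:Z <= s2.
  rewrite /s2 PoszM -[Posz #|_|]natz mulr_natl -sumr_const.
  rewrite [leLHS](eq_bigl (fun c => c \notin small_coefs x w)); last first.
    by move=> c; rewrite !inE.
  apply: ler_sum => c; rewrite inE -leNgt => h.
  rewrite -[leRHS]real_normK ?num_real // -mulnn PoszM expr2.
  by apply: ler_pM.
have := cardsC (small_coefs x w); rewrite card_coefs.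
move: hs2; set e := (_ ^ n)%N; set u := #|small_coefs x w|; set v := #|_|.
move=> h1 h2 h3; have {h1 h3 s10}: (v * (w * M) ^ 2 <= e * (n * (M * d) ^ 2))%N.
  by rewrite -lez_nat; lia.
have -> : (v * (w * M) ^ 2 = (v * w ^ 2) * M ^ 2)%N by lia.
have -> : (e * (n * (M * d) ^ 2) = (e * (n * d ^ 2)) * M ^ 2)%N by lia.
by rewrite leq_pmul2r ?expn_gt0 ?M0 //; nia.
Qed.

End Coefficients.

(** * Splitting an instance into blocks of coordinates *)

Section Concatenation.
Variables (T : finType) (n1 n2 : nat).

Definition fcat (x1 : {ffun 'I_n1 -> T}) (x2 : {ffun 'I_n2 -> T}) :
    {ffun 'I_(n1 + n2) -> T} :=
  [ffun i => match split i with inl j => x1 j | inr k => x2 k end].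

Lemma fcatl x1 x2 i : fcat x1 x2 (lshift n2 i) = x1 i.
Proof. by rewrite ffunE (unsplitK (inl _)). Qed.

Lemma fcatr x1 x2 i : fcat x1 x2 (rshift n1 i) = x2 i.
Proof. by rewrite ffunE (unsplitK (inr _)). Qed.

Lemma card_fcat (P : {ffun 'I_(n1 + n2) -> T} -> bool) :
  #|[set x | P x]| = \sum_x1 #|[set x2 | P (fcat x1 x2)]|.
Proof.
rewrite -sum1_card big_mkcond /=.
rewrite (reindex (fun p => fcat p.1 p.2)) /=; last first.
  exists (fun x : {ffun 'I_(n1 + n2) -> T} =>
    ([ffun i => x (lshift n2 i)], [ffun i => x (rshift n1 i)])).
    move=> [x1 x2] _; congr pair; apply/ffunP => i;
    by rewrite ffunE ?fcatl ?fcatr.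
  move=> x _; apply/ffunP => i; rewrite ffunE.
  by case: splitP => j ij; rewrite ffunE; congr (x _); apply: val_inj.
rewrite -(pair_bigA _ (fun x1 x2 =>
  if fcat x1 x2 \in [set x | P x] then 1 else 0)%N) /=.
apply: eq_bigr => x1 _; rewrite -sum1_card [RHS]big_mkcond /=.
by apply: eq_bigr => x2 _; rewrite !inE.
Qed.

End Concatenation.

Lemma card_fcons (T : finType) n (P : {ffun 'I_(1 + n) -> T} -> bool) :
  #|[set x | P x]| = \sum_(y : T) #|[set x | P (fcat [ffun=> y] x)]|.
Proof.
rewrite card_fcat (reindex (fun y : T => [ffun _ : 'I_1 => y])) //.
exists (fun f : {ffun 'I_1 -> T} => f ord0) => [y|f] _; first by rewrite ffunE.
by apply/ffunP => i; rewrite ffunE (ord1 i).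
Qed.

(** * Growth of the set of reachable points in a window of length [M] *)

Section Reachable.
Variables (d M : nat).

(** The zero vector is allowed here; a nonzero coefficient is supplied separately by the first
    coordinate of the instance. *)
Definition reachable n (x : {ffun 'I_n -> 'I_M}) (t : int) : Prop :=
  exists2 c : 'I_n -> int, (forall i, `|c i| <= d%:Z) & dotp x c = t.

Lemma reachable0 n (x : {ffun 'I_n -> 'I_M}) : reachable x 0.
Proof.
exists (fun=> 0) => [i|]; first by rewrite normr0.
by rewrite /dotp big1 // => i _; rewrite mulr0.
Qed.

Lemma dotp_fcat n1 n2 (x1 : {ffun 'I_n1 -> 'I_M}) (x2 : {ffun 'I_n2 -> 'I_M})
    (c1 : 'I_n1 -> int) (c2 : 'I_n2 -> int) :
  dotp (fcat x1 x2)
    (fun i => match split i with inl j => c1 j | inr k => c2 k end)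
  = dotp x1 c1 + dotp x2 c2.
Proof.
rewrite /dotp big_split_ord /=; congr (_ + _); apply: eq_bigr => i _.
  by rewrite fcatl (unsplitK (inl _)).
by rewrite fcatr (unsplitK (inr _)).
Qed.

Lemma reachable_fcat n1 n2 (x1 : {ffun 'I_n1 -> 'I_M})
    (x2 : {ffun 'I_n2 -> 'I_M}) t1 t2 :
  reachable x1 t1 -> reachable x2 t2 -> reachable (fcat x1 x2) (t1 + t2).
Proof.
move=> [c1 h1 <-] [c2 h2 <-].
exists (fun i => match split i with inl j => c1 j | inr k => c2 k end).
  by move=> i; case: split.
exact: dotp_fcat.
Qed.

Lemma reachable1 (y : 'I_M) (a : int) : `|a| <= d%:Z ->
  reachable [ffun _ : 'I_1 => y] ((y : nat)%:Z * a).
Proof.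
by move=> ad; exists (fun=> a) => //; rewrite /dotp big_ord1 ffunE.
Qed.

Hypothesis d_gt0 : (0 < d)%N.

Lemma reachable_fcons n (y : 'I_M) (x : {ffun 'I_n -> 'I_M}) t a :
  `|a| <= 1 -> reachable x (t - (y : nat)%:Z * a) ->
  reachable (fcat [ffun _ : 'I_1 => y] x) t.
Proof.
move=> a1 h; rewrite -(subrKC ((y : nat)%:Z * a) t).
by apply: reachable_fcat => //; apply: reachable1; lia.
Qed.

(** [S] stands for the points already reached, as offsets from the left end of the window, and [t]
    for the target relative to the same end. The target may lie outside the window, so it is an
    integer. *)
Definition missed n (S : {set 'I_M}) (t : int) :
    {set {ffun 'I_n -> 'I_M}} :=
  [set x | `[< forall s, s \in S -> ~ reachable x (t - (s : nat)%:Z) >]].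

(** This is the part of [S], [S + y] and [S - y] inside the window. A shifted point that leaves the
    window is replaced by [s] itself, which adds nothing; the test [y <= s] guards against truncated
    subtraction. *)
Definition grow (S : {set 'I_M}) (y : 'I_M) : {set 'I_M} :=
  S :|: [set if insub (s + y)%N is Some v then v else s | s : 'I_M in S]
    :|: [set if insub (s - y)%N is Some v then
               if (y <= s)%N then v else s else s | s : 'I_M in S].

Lemma sub_grow (S : {set 'I_M}) y : S \subset grow S y.
Proof. by rewrite /grow -setUA subsetUl. Qed.

Lemma mem_grow (S : {set 'I_M}) (y v s : 'I_M) : s \in S ->
  (s + y = v)%N \/ (v + y = s)%N -> v \in grow S y.
Proof.
move=> sS [h|h]; rewrite !inE.
  apply/orP; left; apply/orP; right; apply/imsetP; exists s => //.
  by rewrite h valK.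
apply/orP; right; apply/imsetP; exists s => //.
by rewrite -h addnK valK leq_addl.
Qed.

Lemma grow_cases (S : {set 'I_M}) (y v : 'I_M) : v \in grow S y ->
  exists2 s, s \in S & exists2 a : int, `|a| <= 1 &
    (v : nat)%:Z = (s : nat)%:Z + (y : nat)%:Z * a.
Proof.
rewrite !inE => /orP[/orP[vS|/imsetP[s sS ->]]|/imsetP[s sS ->]].
- by exists v => //; exists 0 => //; rewrite mulr0 addr0.
- exists s => //; case: insubP => [u _ ->|_].
    by exists 1 => //; rewrite mulr1 PoszD.
  by exists 0 => //; rewrite mulr0 addr0.
- exists s => //; case: insubP => [u _ us|_]; last first.
    by exists 0 => //; rewrite mulr0 addr0.
  case: ifP => [ys|_]; last by exists 0 => //; rewrite mulr0 addr0.
  by exists (-1) => //; move: us; rewrite /=; lia.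
Qed.

Lemma card_grow_le (S : {set 'I_M}) y : (#|grow S y| <= 3 * #|S|)%N.
Proof.
rewrite /grow.
have h (A B : {set 'I_M}) := (leq_card_setU A B).1.
have -> : (3 * #|S| = #|S| + #|S| + #|S|)%N by lia.
apply: leq_trans (h _ _) (leq_add _ (leq_imset_card _ _)).
exact: leq_trans (h _ _) (leq_add (leqnn _) (leq_imset_card _ _)).
Qed.

(* Each s in S puts v into grow S y for y = |s - v|, and each y arises
   from at most two s. *)
Lemma card_grow_mem (S : {set 'I_M}) (v : 'I_M) :
  (#|S| <= 2 * #|[set y | v \in grow S y]|)%N.
Proof.
set Y := [set y | _].

have lt_dist (s : 'I_M) : (v - s + (s - v) < M)%N.
  by have := ltn_ord s; have := ltn_ord v; lia.
pose f s := Ordinal (lt_dist s).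
rewrite -(cardsID [set s : 'I_M | (s < v)%N] S) mul2n -addnn.
have hf s : s \in S -> f s \in Y.
  by move=> sS; rewrite inE; apply: (mem_grow sS) => /=; lia.
apply: leq_add.
  rewrite -(card_in_imset (f := f)).
    apply: subset_leq_card; apply/subsetP => _ /imsetP[s + ->].
    by rewrite inE => /andP[/hf].
  move=> s s'; rewrite !inE => /andP[_ h] /andP[_ h'] /(congr1 val) /= e.
  by apply: val_inj => /=; lia.
rewrite -(card_in_imset (f := f)).
  apply: subset_leq_card; apply/subsetP => _ /imsetP[s + ->].
  by rewrite inE => /andP[_ /hf].
move=> s s'; rewrite !inE => /andP[h _] /andP[h' _] /(congr1 val) /= e.
by apply: val_inj => /=; lia.
Qed.

(** Double counting of the pairs [(y, v)]: a point of [S] is present for every [y], any other point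
    for at least [#|S| / 2] values of [y]. *)
Lemma sum_card_grow (S : {set 'I_M}) :
  (2 * (M * #|S|) + (M - #|S|) * #|S| <= 2 * \sum_(y : 'I_M) #|grow S y|)%N.
Proof.
have -> : (\sum_(y : 'I_M) #|grow S y| = \sum_v #|[set y | v \in grow S y]|)%N.
  under [LHS]eq_bigr do rewrite -sum1_card.
  under [RHS]eq_bigr do rewrite -sum1_card.
  rewrite (exchange_big_dep predT) //=; apply: eq_bigr => v _.
  by apply: eq_bigl => y; rewrite [RHS]inE.
rewrite (bigID (mem S)) /= mulnDr; apply: leq_add.
  rewrite leq_mul2l /= mulnC -sum_nat_const; apply: leq_sum => v vS.
  rewrite -[leqLHS]card_ord -cardsT; apply: subset_leq_card.
  by apply/subsetP => y _; rewrite inE (subsetP (sub_grow S y)).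
rewrite big_distrr /=.
have <- : (#|~: S| = M - #|S|)%N by rewrite cardsCs setCK card_ord.
rewrite -sum_nat_const.
rewrite [leqLHS](eq_bigl (fun v => v \notin S)); last by move=> v; rewrite inE.
by apply: leq_sum => v _; exact: card_grow_mem.
Qed.

Lemma missed_mem n (S : {set 'I_M}) (v : 'I_M) :
  v \in S -> missed n S (v : nat)%:Z = set0.
Proof.
move=> vS; apply/setP => x; rewrite !inE; apply/asboolP => /(_ v vS); apply.
by rewrite subrr; exact: reachable0.
Qed.

(** The first coordinate [y] is spent on the side of [S]: each point of [grow S y] is a point of [S]
    plus [y] times a coefficient in {-1, 0, 1}. *)
Lemma card_missed_grow n (S : {set 'I_M}) t :
  (#|missed n.+1 S t| <= \sum_(y : 'I_M) #|missed n (grow S y) t|)%N.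
Proof.
rewrite /missed (card_fcons (n := n)); apply: leq_sum => y _.
apply: subset_leq_card; apply/subsetP => x; rewrite !inE => /asboolP h.
apply/asboolP => v /grow_cases[s sS [a a1 va]] r; apply: (h s sS).
by apply: reachable_fcons a1 _; rewrite -addrA -opprD -va.
Qed.

(** The first coordinate is spent on the target instead, with one fixed coefficient. *)
Lemma card_missed_shift n (S : {set 'I_M}) t (a : int) : `|a| <= 1 ->
  (#|missed n.+1 S t| <=
     \sum_(y : 'I_M) #|missed n S (t - (y : nat)%:Z * a)%R|)%N.
Proof.
move=> a1; rewrite /missed (card_fcons (n := n)); apply: leq_sum => y _.
apply: subset_leq_card; apply/subsetP => x; rewrite !inE => /asboolP h.
apply/asboolP => s sS r; apply: (h s sS).
by apply: reachable_fcons a1 _; rewrite addrAC.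
Qed.

(** In terms of probability, the failure is at most [2 ^ N * (11 / 12) ^ n * M / #|S|], by induction
    on [n] for all [S], [t] and [N]. [N] bounds the distance of [t] from the window in half-windows;
    each one costs a factor 2, which the expected progress of a coordinate pays for. *)
Lemma card_missed (R : realFieldType) n (S : {set 'I_M}) (t : int) N :
  (0 < #|S|)%N -> - (N * (M %/ 2))%N%:Z <= t -> t < (M + N * (M %/ 2))%N%:Z ->
  #|missed n S t|%:R * #|S|%:R
    <= 2 ^+ N * M%:R * ((11%:R / 12%:R) ^+ n * M%:R ^+ n) :> R.
Proof.
elim: n S t N => [|n IH] S t N S0 tl tr.
  rewrite !expr0 !mulr1; apply: ler_pM => //.
    rewrite -natrX ler_nat (leq_trans (max_card _)) //.
    by rewrite card_ffun !card_ord expn0 expn_gt0.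
  by rewrite ler_nat -[leqRHS]card_ord max_card.
have Spos : 0 < #|S|%:R :> R by rewrite ltr0n.
set q : R := 11%:R / 12%:R in IH *.
pose B K : R := 2 ^+ K * M%:R * (q ^+ n * M%:R ^+ n).
have B0 K : 0 <= B K.
  by rewrite /B /q !mulr_ge0 ?exprn_ge0 ?divr_ge0 ?ler0n.
have -> : 2 ^+ N * M%:R * (q ^+ n.+1 * M%:R ^+ n.+1) = B N * (q * M%:R).
  by rewrite /B !exprS; ring.
have BS K : B K.+1 = 2 * B K by rewrite /B exprS; ring.
(* outside the window, moving t towards it by y >= M / 2 lowers N by one *)
have outside (a : int) K : `|a| <= 1 -> N = K.+1 ->
    (forall y : 'I_M, (y < M %/ 2)%N ->
      #|missed n S (t - (y : nat)%:Z * a)|%:R * #|S|%:R <= B N) ->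
    (forall y : 'I_M, (M %/ 2 <= y)%N ->
      #|missed n S (t - (y : nat)%:Z * a)|%:R * #|S|%:R <= B K) ->
    #|missed n.+1 S t|%:R * #|S|%:R <= B N * (q * M%:R).
  move=> a1 NK hlt hge.
  have h1 : #|missed n.+1 S t|%:R * #|S|%:R <=
     \sum_(y : 'I_M) (#|missed n S (t - (y : nat)%:Z * a)|%:R * #|S|%:R) :> R.
    by rewrite -mulr_suml -natr_sum ler_pM2r // ler_nat card_missed_shift.
  apply: le_trans h1 _.
  apply: (@le_trans _ _
    (\sum_(y : 'I_M) if (y < M %/ 2)%N then B N else B K)).
    by apply: ler_sum => y _; case: ltnP => [/hlt|/hge].
  rewrite -(big_mkord predT (fun y => if (y < M %/ 2)%N then B N else B K)).
  rewrite (big_cat_nat (n := M %/ 2)) ?leq_div //=.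
  rewrite (eq_big_nat _ _ (F2 := fun=> B N)); last by move=> y /andP[_ ->].
  rewrite [X in _ + X](eq_big_nat _ _ (F2 := fun=> B K)); last first.
    by move=> y /andP[h _]; rewrite ltnNge h.
  rewrite !sumr_const_nat NK BS subn0.
  rewrite -(mulr_natl (2 * B K)) -(mulr_natl (B K)) natrB ?leq_div // /q.
  have : 2 * (M %/ 2)%:R <= M%:R :> R by rewrite -natrM ler_nat; lia.
  have := B0 K; set b := B K; set u := (M %/ 2)%:R; set m := M%:R.
  move=> b0 um; have : 0 <= b * (m - 2 * u) by rewrite mulr_ge0 ?subr_ge0.
  have : 0 <= b * m by rewrite mulr_ge0 // ler0n.
  nra.
have [t0|t0] := ltP t 0.
  case: N tl tr outside => [|K] tl tr outside; first lia.
  have yM (y : 'I_M) := ltn_ord y.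
  by apply: (outside (-1) K) => // y yh; apply: IH => //; have := yM y; nia.
have [tM|tM] := leP M%:Z t.
  case: N tl tr outside => [|K] tl tr outside; first lia.
  have yM (y : 'I_M) := ltn_ord y.
  by apply: (outside 1 K) => // y yh; apply: IH => //; have := yM y; nia.
have [v ->] : exists v : 'I_M, t = (v : nat)%:Z.
  have tM' : (absz t < M)%N by lia.
  by exists (Ordinal tM') => /=; lia.
have IHv (S' : {set 'I_M}) : (0 < #|S'|)%N ->
   #|missed n S' (v : nat)%:Z|%:R * #|S'|%:R <= B N.
  by move=> S'0; apply: IH => //; have := ltn_ord v; lia.
have h1 : #|missed n.+1 S (v : nat)%:Z|%:R * #|S|%:R <=
     \sum_(y : 'I_M) (#|missed n (grow S y) (v : nat)%:Z|%:R * #|S|%:R) :> R.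
  by rewrite -mulr_suml -natr_sum ler_pM2r // ler_nat card_missed_grow.
apply: le_trans h1 _.
have gS y : (#|S| <= #|grow S y|)%N := subset_leq_card (sub_grow S y).
have [S2|S2] := leqP (2 * #|S|) M.
  (* 1 / u <= (4 - u) / 3 for u in [1, 3], with u = #|grow S y| / #|S| *)
  have h2 y : #|missed n (grow S y) (v : nat)%:Z|%:R * #|S|%:R <=
     B N / (3 * #|S|%:R) * (4 * #|S|%:R - #|grow S y|%:R).
    have := IHv _ (leq_trans S0 (gS y)).
    have : #|S|%:R <= #|grow S y|%:R :> R by rewrite ler_nat.
    have : #|grow S y|%:R <= 3 * #|S|%:R :> R.
      by rewrite -natrM ler_nat card_grow_le.
    have : 0 <= #|missed n (grow S y) (v : nat)%:Z|%:R :> R by [].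
    set g := #|grow S y|%:R; set s := #|S|%:R in Spos *; set u := #|_|%:R.
    move=> u0 g3 g1 ug.
    have s3 : 0 < 3 * s by rewrite mulr_gt0.
    rewrite mulrAC ler_pdivlMr //.
    have g0 : 0 < g by apply: lt_le_trans g1.
    apply: (@le_trans _ _ (u * g * (4 * s - g))); last first.
      by apply: ler_wpM2r => //; lra.
    have -> : u * s * (3 * s) = u * (3 * s ^+ 2) by ring.
    have -> : u * g * (4 * s - g) = u * (g * (4 * s - g)) by ring.
    by apply: ler_wpM2l => //; nra.
  apply: le_trans (ler_sum _ (fun y _ => h2 y)) _.
  rewrite -mulr_sumr sumrB sumr_const card_ord -natr_sum.
  rewrite mulrAC ler_pdivrMr ?mulr_gt0 // -[leRHS]mulrA; apply: ler_wpM2l => //.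
  (* For [#|S| <= M / 2] the mean of [#|grow S y|] is at least [5 / 4 * #|S|], and
     [(4 - 5 / 4) / 3 = 11 / 12] is the value of [q]. *)
  have := sum_card_grow S; set G := \sum_y _; rewrite -(ler_nat R).
  rewrite natrD !natrM natrB; last by lia.
  have : 2 * #|S|%:R <= M%:R :> R by rewrite -natrM ler_nat.
  rewrite -(mulr_natl (4 * _)) /q; set s := #|S|%:R in Spos *; set m := M%:R.
  by set g := G%:R; nra.
(* Now [#|S|] exceeds [M / 2], so more than a quarter of the [y] put the target into [grow S y] and
   leave nothing missed; the others are covered by the induction hypothesis. *)
set Y := [set y | v \in grow S y].
apply: (@le_trans _ _ (\sum_(y | y \notin Y) B N)).
  rewrite [leRHS]big_mkcond /=; apply: ler_sum => y _.
  have [yY|yY] := boolP (y \in Y) => /=.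
    rewrite missed_mem ?cards0 ?mul0r //.
    by move: yY; rewrite inE.
  apply: le_trans (IHv _ (leq_trans S0 (gS y))).
  by apply: ler_wpM2l; rewrite // ler_nat.
rewrite (eq_bigl (mem (~: Y))); last by move=> y; rewrite !inE.
rewrite sumr_const -(mulr_natr (B N)); apply: ler_wpM2l => //; rewrite /q.
have := card_grow_mem S v; have := cardsC Y; rewrite card_ord -/Y => e1 e2.
have : (12 * #|~: Y| <= 11 * M)%N by lia.
rewrite -(ler_nat R) !natrM; set a := #|_|%:R; lra.
Qed.

End Reachable.

(** * Dense windows and the number of unsolvable instances *)

Lemma sqr_card_le (T U : finType) (f : T -> U) (A : {set T}) :
  (#|A| ^ 2 <= #|f @: A| *
    #|[set p : T * T | [&& p.1 \in A, p.2 \in A & f p.1 == f p.2]]|)%N.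
Proof.
(* With [r u] the size of a fibre, [#|A|] is the sum of the [r u] and the number of colliding pairs
   is the sum of their squares. *)
pose r u := #|[set c in A | f c == u]|.
have -> : #|A| = (\sum_(u in f @: A) r u)%N.
  rewrite -sum1_card (partition_big f (mem (f @: A))) /=; last first.
    by move=> c cA; exact: imset_f.
  apply: eq_bigr => u _; rewrite /r -sum1_card.
  by apply: eq_bigl => c; rewrite inE.
set P := [set p : T * T | _].
have -> : #|P| = (\sum_(u in f @: A) r u ^ 2)%N.
  rewrite -sum1_card (partition_big (fun p => f p.1) (mem (f @: A))) /=;
    last first.
    by move=> p; rewrite inE => /and3P[pA _ _]; exact: imset_f.
  apply: eq_bigr => u _; rewrite -mulnn /r -cardsX -sum1_card.
  apply: eq_bigl => -[c c']; rewrite !inE /=.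
  by have [<-|cu] := eqVneq (f c) u; rewrite ?andbT ?andbF //
    [f c' == _]eq_sym andbA.
rewrite -(leq_pmul2l (ltn0Sn 1)) -mulnn.
(* Cauchy-Schwarz, by summing [2 * (r u * r v) <= r u ^ 2 + r v ^ 2] over all pairs of values. *)
apply: (@leq_trans (\sum_(u in f @: A) \sum_(v in f @: A) (r u ^ 2 + r v ^ 2))).
  rewrite big_distrlr /= big_distrr /=; apply: leq_sum => u _.
  by rewrite big_distrr /=; apply: leq_sum => v _; exact: nat_Cauchy.
under eq_bigr do rewrite big_split /= sum_nat_const.
rewrite big_split /= sum_nat_const -big_distrr /=. lia.
Qed.

Section Instances.
Variables d M : nat.
Hypothesis M_gt0 : (0 < M)%N.

Definition window_values n (x : {ffun 'I_n -> 'I_M}) (a : int) : {set 'I_M} :=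
  [set i : 'I_M | `[< reachable d x (a + (i : nat)%:Z) >]].

(** The interval of small values is cut into [2 * w] windows of length [M]. One of them receives at
    least a fraction [1 / (4 * w)] of all vectors, and squaring this in Cauchy-Schwarz gives
    [16 * w ^ 2]. *)
Lemma dense_window n (x : {ffun 'I_n -> 'I_M}) w : (2 * d ^ 2 * n < w ^ 2)%N ->
  exists2 a : int, `|a| <= (w * M)%N%:Z &
    (((2 * d).+1 ^ n) ^ 2
       <= 16 * w ^ 2 * #|window_values x a| * #|collisions d x|)%N.
Proof.
move=> hw; have := card_small_coefs x M_gt0 hw.
set A := small_coefs d x w => hA.
have w0 : (0 < w)%N by case: w hw {A hA} => //; rewrite exp0n.
(* Shifted by [w * M], the small values become natural numbers, whose quotient and remainder by [M]
   are the window and the offset in it. *)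
pose v (c : {ffun 'I_n -> C0 d}) : nat :=
  absz (dotp x (fun i => val (c i)) + (w * M)%N%:Z).
have vE c : c \in A -> (v c)%:Z = dotp x (fun i => val (c i)) + (w * M)%N%:Z.
  rewrite inE ltr_norml /v => /andP[].
  by set D := dotp _ _; set W := (w * M)%N; lia.
have vlt c : (v c %/ M < 2 * w)%N || (c \notin A).
  have [cA|] := boolP (c \in A); rewrite ?orbT //= orbF ltn_divLR //.
  move: (vE c cA); move: cA; rewrite inE ltr_norml -mulnA => /andP[].
  by set D := dotp _ _; set W := (w * M)%N; lia.
have w20 : (0 < 2 * w)%N by rewrite muln_gt0.
pose kf c : 'I_(2 * w) := insubd (Ordinal w20) (v c %/ M)%N.
have kfE c : c \in A -> kf c = (v c %/ M)%N :> nat.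
  by move=> cA; rewrite val_insubd; move: (vlt c); rewrite cA orbF => ->.
pose Ak k := [set c in A | kf c == k].
have [k hk] : exists k, (#|A| <= 2 * w * #|Ak k|)%N.
  exists [arg max_(k > Ordinal w20) #|Ak k|]; case: arg_maxnP => // k _ kmax.
  rewrite -sum1_card (partition_big kf predT) //=.
  apply: (@leq_trans (\sum_(j < 2 * w) #|Ak k|)%N); last first.
    by rewrite sum_nat_const card_ord.
  apply: leq_sum => j _; apply: leq_trans (kmax j isT).
  by rewrite -sum1_card; apply: eq_leq; apply: eq_bigl => c; rewrite [RHS]inE.
pose rf c : 'I_M := Ordinal (ltn_pmod (v c) M_gt0).
exists (k%:Z * M%:Z - (w * M)%N%:Z).
  by have := ltn_ord k; rewrite ler_norml; nia.
set a := _ - _.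
have dE c : c \in Ak k ->
    dotp x (fun i => val (c i)) = a + (rf c : nat)%:Z.
  rewrite inE => /andP[cA /eqP ck]; have := kfE c cA; have := vE c cA.
  by rewrite ck /= => h1 h2; rewrite /a h2; have := divn_eq (v c) M; lia.
have := sqr_card_le rf (Ak k).
have h1 : (#|rf @: Ak k| <= #|window_values x a|)%N.
  apply: subset_leq_card; apply/subsetP => _ /imsetP[c cA ->].
  rewrite inE; apply/asboolP; exists (fun i => val (c i)); last exact: dE.
  by move=> i; exact: coef_le.
set P := [set p : _ * _ | _].
have h2 : (#|P| <= #|collisions d x|)%N.
  apply: subset_leq_card; apply/subsetP => p; rewrite inE.
  by move=> /and3P[pA pA' /eqP e]; rewrite inE (dE _ pA) (dE _ pA') e.
have h3 : ((2 * d).+1 ^ n <= 4 * w * #|Ak k|)%N by lia.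
move=> h4.
have : (((2 * d).+1 ^ n) ^ 2 <= (4 * w * #|Ak k|) ^ 2)%N by rewrite leq_sqr.
move=> /leq_trans; apply.
have -> : ((4 * w * #|Ak k|) ^ 2 = 16 * w ^ 2 * #|Ak k| ^ 2)%N by lia.
by rewrite -[leqRHS]mulnA leq_mul2l (leq_trans h4 (leq_mul h1 h2)) orbT.
Qed.

Lemma mem_solvable n (x : {ffun 'I_n -> 'I_M}) (c : 'I_n -> int) i t :
  (forall j, `|c j| <= d%:Z) -> c i != 0 -> dotp x c = t ->
  x \in solvable_instances (C0 d) n M t.
Proof.
move=> cd ci <-; rewrite inE; apply/existsP.
have cC j : c j \in C0 d by rewrite in_C0.
exists [ffun j => FSetSub (cC j) : C0 d]; apply/andP; split.
  by apply/existsP; exists i; rewrite ffunE.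
by apply/eqP; apply: eq_bigr => j _; rewrite ffunE.
Qed.

(** The constant 32 is 16 from the dense window times 2 from the mean number of collisions. In
    [w + 1], [w] bounds the position of the window and 1 the contribution of the first
    coordinate. *)
Lemma card_unsolvable (R : realFieldType) n1 n2 (tau : int) w N :
  (0 < d)%N -> (1 < M)%N -> (M <= (2 * d).+1 ^ n1)%N ->
  (2 * d ^ 2 * n1 < w ^ 2)%N ->
  `|tau| + ((w + 1) * M)%N%:Z <= (N * (M %/ 2))%N%:Z ->
  #|~: solvable_instances (C0 d) (1 + (n1 + n2)) M tau|%:R
    <= 32%:R * w%:R ^+ 2 * 2 ^+ N * (11%:R / 12%:R) ^+ n2 *
       M%:R ^+ (1 + (n1 + n2)) :> R.
Proof.
move=> d0 M1 Mn1 hw htau.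
set Sol := solvable_instances _ _ _ _.
set e := ((2 * d).+1 ^ n1)%N in Mn1 *.
pose b : R := 2 ^+ N * M%:R * ((11%:R / 12%:R) ^+ n2 * M%:R ^+ n2).
have b0 : 0 <= b by rewrite /b !mulr_ge0 ?exprn_ge0 ?divr_ge0 ?ler0n.
have e0 : 0 < e%:R :> R by rewrite ltr0n expn_gt0.
have M0 : 0 < M%:R :> R by rewrite ltr0n.
pose U (y : 'I_M) (x : {ffun 'I_n1 -> 'I_M}) :=
  [set z : {ffun 'I_n2 -> 'I_M} |
    fcat [ffun _ : 'I_1 => y] (fcat x z) \notin Sol].
have cU y x : #|U y x|%:R * (e%:R ^+ 2) <=
    b * (16%:R * w%:R ^+ 2) * #|collisions d x|%:R :> R.
  have [a aw] := dense_window x hw; rewrite -/e.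
  set S := window_values x a => hS.
  have S0 : (0 < #|S|)%N.
    rewrite lt0n; apply/eqP => S0; move: hS; rewrite S0 muln0 mul0n leqn0.
    by rewrite expn_eq0 andbT expn_eq0.
  (* What remains of the target after the first coordinate, with coefficient 1, and the left end of
     the window are subtracted. *)
  pose t := tau - (y : nat)%:Z - a.
  have sub : U y x \subset missed d n2 S t.
    apply/subsetP => z; rewrite inE => zS; rewrite inE.
    apply/asboolP => s; rewrite inE => /asboolP rx rz; case/negP: zS.
    have [c cd cE] := reachable_fcat rx rz.
    apply: (@mem_solvable _ _ (fun i => match split i with
       inl _ => 1 | inr k => c k end) (lshift _ ord0)).
    - by move=> j; case: split => // _; rewrite normr1; lia.
    - by rewrite (unsplitK (inl _)).
    rewrite (dotp_fcat _ _ (fun=> 1)) cE /dotp big_ord1 ffunE mulr1 /t.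
    lia.
  have [tl tr] : - (N * (M %/ 2))%N%:Z <= t /\ t < (M + N * (M %/ 2))%N%:Z.
    have yM := ltn_ord y.
    move: aw htau; rewrite /t ler_norml => /andP[]; lia.
  have hm := card_missed d0 R n2 S0 tl tr; rewrite -/b in hm.
  have hm2 : #|U y x|%:R * #|S|%:R <= b.
    apply: le_trans hm; rewrite ler_pM2r ?ltr0n // ler_nat.
    exact: subset_leq_card.
  have {}hS : e%:R ^+ 2 <=
      16%:R * w%:R ^+ 2 * #|S|%:R * #|collisions d x|%:R :> R.
    by rewrite -!natrX -!natrM ler_nat.
  apply: le_trans (ler_wpM2l (ler0n _ _) hS) _.
  set k := #|collisions d x|%:R.
  have -> : #|U y x|%:R * (16%:R * w%:R ^+ 2 * #|S|%:R * k) =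
     (#|U y x|%:R * #|S|%:R) * (16%:R * w%:R ^+ 2 * k) by ring.
  rewrite -[leRHS]mulrA; apply: ler_wpM2r => //.
  by rewrite !mulr_ge0 ?exprn_ge0 ?ler0n.
have -> : #|~: Sol| = (\sum_(y : 'I_M) \sum_x #|U y x|)%N.
  have -> : ~: Sol = [set x | x \notin Sol] by apply/setP => x; rewrite !inE.
  rewrite card_fcons; apply: eq_bigr => y _; rewrite card_fcat.
  by apply: eq_bigr.
have hC := sum_collisions (d := d) Mn1; rewrite -big_distrl /= -/e in hC.
have hx y : (\sum_x #|U y x|)%:R * M%:R <=
    b * (32%:R * w%:R ^+ 2) * M%:R ^+ n1 :> R.
  rewrite -(ler_pM2r (exprn_gt0 2 e0)) mulrAC natr_sum mulr_suml.
  apply: le_trans (ler_wpM2r (ltW M0) (ler_sum _ (fun x _ => cU y x))) _.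
  rewrite -mulr_sumr -natr_sum -mulrA -natrM.
  rewrite -(ler_nat R) (mulnC 2 n1) expnM -/e in hC.
  apply: le_trans (ler_wpM2l _ hC) _; first by rewrite !mulr_ge0 ?exprn_ge0.
  by rewrite !natrM !natrX le_eqVlt; apply/orP; left; apply/eqP; ring.
rewrite natr_sum -(ler_pM2r M0) mulr_suml.
apply: le_trans (ler_sum _ (fun y _ => hx y)) _.
rewrite sumr_const card_ord -mulr_natl /b !exprD expr1 le_eqVlt.
by apply/orP; left; apply/eqP; ring.
Qed.

End Instances.

(** * Numerical estimates and the choice of block lengths *)

Lemma decay_le (R : realFieldType) q m : (96 * q <= m)%N -> (5 <= q)%N ->
  32%:R * (q.+1)%:R ^+ 2 * 2 ^+ (6 * q + 9) * (11%:R / 12%:R) ^+ m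
    <= 2^-1 ^+ q :> R.
Proof.
move=> mq q5.
(* Everything is compared with powers of [P]: [q + 1 <= P^-1], [2 ^ (6 * q + 9) = 512 * P^-1 ^+ 6],
   and [(11 / 12) ^ 8 <= 1 / 2] gives [P ^+ 12] for the last factor. The product is
   [16384 * P ^+ 4], and [P <= 1 / 32] absorbs the constant. *)
set P : R := 2^-1 ^+ q.
have P0 : 0 < P by rewrite exprn_gt0 // invr_gt0.
have P32 : P <= 32^-1.
  rewrite (_ : 32^-1 = 2^-1 ^+ 5 :> R); first by apply: ler_wiXn2l => //; lra.
  by rewrite exprVn; congr (_^-1); rewrite !exprS expr0; ring.
have h1 : (11%:R / 12%:R) ^+ m <= P ^+ 12 :> R.
  apply: (@le_trans _ _ ((11%:R / 12%:R) ^+ (8 * (q * 12)))).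
    by apply: ler_wiXn2l; [lra|lra|lia].
  rewrite exprM /P -[leRHS]exprM; apply: lerXn2r; rewrite ?nnegrE ?exprn_ge0 //.
  by lra.
have PV : P^-1 = 2 ^+ q by rewrite /P exprVn invrK.
have h2 : q.+1%:R <= P^-1.
  by rewrite PV -natrX ler_nat ltn_expl.
have -> : 2 ^+ (6 * q + 9) = 512%:R * P^-1 ^+ 6 :> R.
  rewrite exprD mulrC PV -exprM [(q * 6)%N]mulnC; congr (_ * _).
  by rewrite !exprS expr0; ring.
apply: (@le_trans _ _ (32%:R * P^-1 ^+ 2 * (512%:R * P^-1 ^+ 6) * P ^+ 12)).
  have Pi0 : 0 <= P^-1 by rewrite invr_ge0 ltW.
  have h3 : q.+1%:R ^+ 2 <= P^-1 ^+ 2 by apply: lerXn2r; rewrite ?nnegrE.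
  have h4 : 0 <= 32%:R * q.+1%:R ^+ 2 * (512%:R * P^-1 ^+ 6).
    apply: mulr_ge0; apply: mulr_ge0; rewrite ?ler0n //; exact: exprn_ge0.
  apply: (@le_trans _ _
    (32%:R * q.+1%:R ^+ 2 * (512%:R * P^-1 ^+ 6) * P ^+ 12)).
    exact: ler_wpM2l.
  apply: ler_wpM2r.
    by rewrite exprn_ge0 ?ltW.
  by apply: ler_wpM2r; [apply: mulr_ge0; [exact: ler0n|exact: exprn_ge0] | lra].
have -> : 32%:R * P^-1 ^+ 2 * (512%:R * P^-1 ^+ 6) * P ^+ 12 =
    16384%:R * P ^+ 3 * P by field; rewrite gt_eqF.
rewrite ler_piMl ?(ltW P0) //.
have : P ^+ 3 <= 32^-1 ^+ 3.
  by apply: lerXn2r => //; rewrite nnegrE ?ltW // invr_ge0.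
by rewrite !exprS expr0; lra.
Qed.

Section Asymptotics.
Variables (R : realType) (d : nat).

Lemma unif_probC (T : finType) (A : {set T}) : (0 < #|T|)%N ->
  unif_prob R A = 1 - #|~: A|%:R / #|T|%:R.
Proof.
move=> T0; have T1 : #|T|%:R != 0 :> R by rewrite pnatr_eq0 -lt0n.
rewrite /unif_prob -(cardsC A) natrD in T1 *.
by apply: (mulIf T1); rewrite mulfVK // mulrBl mul1r mulfVK // addrK.
Qed.

Lemma unif_prob_solvable_le n M tau : ((2 * d).+1 ^ n <= M)%N ->
  unif_prob R (solvable_instances (C0 d) n M tau)
    <= ((2 * d).+1 ^ n)%:R / M%:R.
Proof.
move=> hM; have M0 : (0 < M)%N by apply: leq_trans hM; rewrite expn_gt0.
rewrite /unif_prob card_ffun !card_ord ler_pdivrMr ?ltr0n ?expn_gt0 ?M0 //.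
rewrite mulrAC ler_pdivlMr ?ltr0n // -!natrM ler_nat.
exact: solvable_union_bound.
Qed.

Lemma expR_decay l n q : (0 < l)%N -> (n <= 2 * q * l)%N ->
  2^-1 ^+ q <= expR (- ((4 * l)%:R^-1 * n%:R)) :> R.
Proof.
move=> l0 nq; apply: (@le_trans _ _ (expR (- 2^-1) ^+ q)).
  apply: lerXn2r; rewrite ?nnegrE ?expR_ge0 //.
  by have := expR_ge1Dx (- 2^-1 : R); lra.
rewrite -expRM_natl ler_expR mulrN lerN2 mulrC ler_pdivrMr ?ltr0n ?muln_gt0 //.
rewrite -mulrA [2^-1 * _]mulrC mulrA ler_pdivlMr // -!natrM ler_nat; lia.
Qed.

Lemma unif_prob_solvable_ge k n M (tau : int) : (0 < d)%N -> (1 < k)%N ->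
  (1 < M)%N ->
  (480 * k <= n)%N -> (2 * d ^ 2 * (96 * k) ^ 2 <= n)%N ->
  (M <= (2 * d).+1 ^ (n - (n %/ k).+1))%N ->
  `|tau| * (96 * k)%N%:Z <= (M * n)%N%:Z ->
  1 - expR (- ((4 * (96 * k))%:R^-1 * n%:R))
    <= unif_prob R (solvable_instances (C0 d) n M tau).
Proof.
move=> d0 k1 M1 hn hnd hM htau.
set l := (96 * k)%N in hnd htau *; have l0 : (0 < l)%N by lia.
(* The parameters will be [w = q + 1] and [N = 6 * q + 9], linear in [n] but small enough against
   [n2] for the decay to win. *)
pose q := (n %/ l)%N; pose n1 := (n - (n %/ k).+1)%N; pose n2 := (n %/ k)%N.
have nE : n = (1 + (n1 + n2))%N.
  have nk : (n %/ k < n)%N by rewrite ltn_Pdiv; lia.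
  by rewrite /n1 /n2; lia.
have q5 : (5 <= q)%N by rewrite /q leq_divRL // /l; lia.
have nlt : (n < q.+1 * l)%N by exact: ltn_ceil.
have T0 : (0 < #|{: {ffun 'I_n -> 'I_M}}|)%N.
  by rewrite card_ffun !card_ord expn_gt0; apply/orP; left; lia.
rewrite unif_probC // lerD2l lerN2.
apply: le_trans (expR_decay l0 (_ : n <= 2 * q * l)%N); last by nia.
have q96 : (96 * q <= n2)%N.
  by rewrite /n2 leq_divRL; [rewrite /q; have := leq_trunc_div n l; nia|lia].
apply: le_trans (decay_le R q96 q5).
rewrite ler_pdivrMr ?ltr0n // card_ffun !card_ord natrX.
move: hM htau; rewrite -/n1 {1}nE => hM htau.
rewrite [in X in X <= _]nE [in leRHS]nE.
apply: card_unsolvable => //.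
- by lia.
(* From [n < (q + 1) * l] and [2 * d ^ 2 * l ^ 2 <= n] follows [2 * d ^ 2 * n1 < (q + 1) ^ 2]. *)
- by nia.
have {}htau : (absz tau <= M * q.+1)%N.
  have : (absz tau * l <= M * n)%N by rewrite nE; lia.
  move=> /leq_trans h; rewrite -(leq_pmul2r l0); apply: h.
  by rewrite -mulnA leq_mul2l ltnW ?orbT.
(* As [M > 1], half-windows are at least [M / 3] long, so [6 * q + 9] of them cover
   [(2 * q + 3) * M]: [q + 1] windows for [tau] and [q + 2] for [w + 1]. *)
have M3 : (M <= 3 * (M %/ 2))%N by lia.
have : (absz tau + (q.+1 + 1) * M <= (6 * q + 9) * (M %/ 2))%N.
  apply: (@leq_trans (M * (2 * q + 3))); first by lia.
  by apply: leq_trans (leq_mul M3 (leqnn _)) _; lia.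
by lia.
Qed.

End Asymptotics.

(** * Fixing the constants for a given [eps] *)

Local Open Scope classical_set_scope.
Local Open Scope ring_scope.

Theorem mainTheorem5 (R : realType) (d : nat) (eps : R)
    (hd : (1 <= d)%N) (heps : 0 < eps)
    (M : nat -> nat) (tau : nat -> int)
    (hM : exists2 c : R, 0 < c &
      \forall n \near \oo, (#|` C0 d|%fset%:R : R) `^ (c * n%:R) <= (M n)%:R)
    (htau : (fun n => (tau n)%:~R : R) =o_\oo (fun n => (M n * n)%:R : R)) :
  (exists2 delta : R, 0 < delta &
     \forall n \near \oo,
       (M n)%:R <= (#|` C0 d|%fset%:R : R) `^ ((1 - eps) * n%:R) ->
       1 - expR (- (delta * n%:R))
         <= unif_prob R (solvable_instances (C0 d) n (M n) (tau n)))
  /\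
  (forall n : nat,
     (#|` C0 d|%fset%:R : R) ^+ n <= (M n)%:R ->
     unif_prob R (solvable_instances (C0 d) n (M n) (tau n))
       <= (#|` C0 d|%fset%:R : R) ^+ n / (M n)%:R).
Proof.
rewrite card_C0 in hM *; split; last first.
  by move=> n; rewrite -natrX ler_nat; exact: unif_prob_solvable_le.
have [c c0 hMc] := hM.
(* With [eps * k >= 2], [n %/ k + 1 <= eps * n] for large [n], so the bound on [M] leaves room for
   the last block and the first coordinate. The resulting rate depends on [eps] alone. *)
pose k := (Num.truncn (2 / eps)).+2; pose l := (96 * k)%N.
have k2 : 2 <= eps * k%:R.
  have : 2 / eps < k%:R.
    by apply: lt_le_trans (truncnS_gt _) _; rewrite ler_nat.
  by rewrite ltr_pdivrMr // mulrC => /ltW.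
exists (4 * l)%:R^-1; first by rewrite invr_gt0 ltr0n.
have l0 : 0 < l%:R^-1 :> R by rewrite invr_gt0 ltr0n.
have ht : \forall n \near \oo,
    `|(tau n)%:~R : R| <= l%:R^-1 * `|(M n * n)%:R : R|.
  by move/eqoP: htau => /(_ _ l0).
near=> n.
have C1 : 1 < (2 * d).+1%:R :> R by rewrite ltr1n; lia.
have nbig : (480 * k + 2 * d ^ 2 * (96 * k) ^ 2 <= n)%N.
  by near: n; exact: nbhs_infty_ge.
move=> hMn.
have nk : (n %/ k < n)%N by rewrite ltn_Pdiv //; apply: leq_trans nbig; lia.
apply: unif_prob_solvable_ge => //.
(* The standing lower bound on [M] gives [1 < M]. *)
- rewrite -(ltr_nat R); apply: (@lt_le_trans _ _ ((2 * d).+1%:R `^ (c * n%:R))).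
    rewrite /powR pnatr_eq0 /= expR_gt1 mulr_gt0 ?ln_gt0 // mulr_gt0 //.
    by rewrite ltr0n; exact: leq_trans nk.
  by near: n.
- by apply: leq_trans nbig; exact: leq_addr.
- by apply: leq_trans nbig; exact: leq_addl.
- rewrite -(ler_nat R) natrX -powR_mulrn ?ler0n //.
  apply: le_trans hMn _; apply: ler_powR; first exact: ltW.
  rewrite natrB // mulrBl mul1r lerD2l lerN2.
  rewrite -(ler_pM2r (_ : 0 < k%:R)) ?ltr0n //.
  apply: (@le_trans _ _ ((2 * n)%:R)); last first.
    by rewrite natrM mulrAC ler_wpM2r.
  by rewrite -natrM ler_nat; have := leq_trunc_div n k; move: nbig; clear; nia.
- have : `|(tau n)%:~R : R| <= l%:R^-1 * `|(M n * n)%:R : R| by near: n.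
  rewrite [X in _ * X]ger0_norm // mulrC ler_pdivlMr ?ltr0n // -intr_norm.
  by rewrite (pmulrn 1 l) (pmulrn 1 (M n * n)) -intrM ler_int.
Unshelve. all: by end_near.
Qed.
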